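(* Let $X$ be a real Banach space such that for every $x^\ast \in \partial_e X^\ast_1$ there is a closed subspace $N \subset X^\ast$ with $X^\ast = \mathrm{span}\{x^\ast\} \oplus_1 N$. Let $x \in X$ be a very smooth point. Then $x$ is a Fréchet smooth point of $X$.
   Context: $X_1$ denotes the closed unit ball of a Banach space $X$ and $\partial_e C$ the set of extreme points of a convex set $C$; so $\partial_e X^\ast_1$ is the set of extreme points of the dual unit ball. $X^\ast = M \oplus_1 N$ means that $X^\ast$ is the algebraic direct sum of the closed subspaces $M, N$ and $\|m+n\| = \|m\|+\|n\|$ for all $m\in M$, $n \in N$. A non-zero $x \in X$ is a smooth point of $X$ if there is a unique norm-one $x_0^\ast \in X^\ast$ with $x_0^\ast(x) = \|x\|$. A smooth point $x$ of $X$ is very smooth if it is also a smooth point of $X^{\ast\ast}$ (with $X$ canonically embedded in $X^{\ast\ast}$). A smooth point $x$ is Fréchet smooth if $\lim_{y \to 0} \frac{\|x+y\| - \|x\| - x_0^\ast(y)}{\|y\|} = 0$. *)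

(* Defs.v *)
From HB Require Import structures.
From mathcomp Require Import all_boot all_order all_algebra.
From mathcomp Require Import boolp classical_sets functions reals.
From mathcomp Require Import topology normedtype.

Set Implicit Arguments.
Unset Strict Implicit.
Unset Printing Implicit Defensive.

Import Order.TTheory GRing.Theory Num.Theory.
Import numFieldNormedType.Exports.

Local Open Scope classical_set_scope.
Local Open Scope ring_scope.

Definition closed_unit_ball (R : realType) (E : normedModType R) : set E :=
  [set x | `|x| <= 1].
Arguments closed_unit_ball {R} E.

Section Dual.
Variables (R : realType) (E : normedModType R).

Definition dual_pred : {pred E -> R^o} :=
  fun f => `[< linear f /\ continuous f >].

(* The topological dual: continuous linear functionals, with the pointwise
   vector space structure and the operator norm. *)
Record dual := Dual {
  dual_fun :> E -> R^o ;
  dual_funP : dual_fun \in dual_pred }.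

HB.instance Definition _ := [isSub of dual for dual_fun].
HB.instance Definition _ := [Choice of dual by <:].

Lemma dual_pred_submod_closed : submod_closed dual_pred.
Proof.
split=> [|a f g /asboolP[lf cf] /asboolP[lg cg]]; apply/asboolP; split.
- by move=> k u v; rewrite scaler0 addr0.
- by move=> x; exact: cvg_cst.
- move=> k u v; rewrite !fctE lf lg !scalerDr !scalerA (mulrC a k).
  by rewrite addrACA.
- move=> x; apply: (@cvgD R _ _ _ _ (a \*: f) g (a *: f x) (g x)).
    by apply: cvgZl_tmp; exact: cf.
  exact: cg.
Qed.

HB.instance Definition _ :=
  GRing.isSubmodClosed.Build R (E -> R^o) dual_pred dual_pred_submod_closed.
HB.instance Definition _ := [SubChoice_isSubLmodule of dual by <:].

Implicit Types f g : dual.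

Lemma dual_linear f : linear f.
Proof. by have /asboolP[] := dual_funP f. Qed.

HB.instance Definition _ f :=
  GRing.isLinear.Build R E R^o *:%R (dual_fun f) (dual_linear f).

Lemma dual_continuous f : continuous f.
Proof. by have /asboolP[] := dual_funP f. Qed.

Lemma dualD f g x : (f + g) x = f x + g x.
Proof. by []. Qed.

Lemma dualZ (a : R) f x : (a *: f) x = a * f x.
Proof. by []. Qed.

Lemma dualP f g : f =1 g -> f = g.
Proof. by move=> fg; apply/val_inj/funext. Qed.

Definition dual_norm f : R := sup [set `|f x| | x in closed_unit_ball E].

Let dual_norm_has_sup f : has_sup [set `|f x| | x in closed_unit_ball E].
Proof.
split; first by exists `|f 0|; exists 0 => //; rewrite /closed_unit_ball/= normr0.
have /bounded_funP/(_ 1)[M fM] :=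
  continuous_linear_bounded 0 (@dual_continuous f 0).
by exists M => _ [x x1 <-]; exact: fM.
Qed.

Lemma dual_norm_ge f x : `|x| <= 1 -> `|f x| <= dual_norm f.
Proof. by move=> x1; apply: (ub_le_sup (dual_norm_has_sup f).2); exists x. Qed.

Lemma dual_norm_le f M : (forall x, `|x| <= 1 -> `|f x| <= M) ->
  dual_norm f <= M.
Proof.
move=> fM; apply: (ge_sup (dual_norm_has_sup f).1) => _ [x x1 <-].
exact: fM.
Qed.

Lemma dual_norm_ge0 f : 0 <= dual_norm f.
Proof. by rewrite (le_trans _ (@dual_norm_ge f 0 _)) ?normr0. Qed.

Lemma le_dual_norm f x : `|f x| <= dual_norm f * `|x|.
Proof.
have [->|x0] := eqVneq x 0; first by rewrite linear0 !normr0 mulr0.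
have nx0 : 0 < `|x| by rewrite normr_gt0.
rewrite -ler_pdivrMr// mulrC.
have -> : `|x|^-1 * `|f x| = `|f (`|x|^-1 *: x)|.
  by rewrite linearZ normrM ger0_norm// invr_ge0.
by apply: dual_norm_ge; rewrite normrZ ger0_norm ?invr_ge0// mulVf ?gt_eqF.
Qed.

Lemma dual_normD f g : dual_norm (f + g) <= dual_norm f + dual_norm g.
Proof.
apply: dual_norm_le => x x1; rewrite dualD (le_trans (ler_normD _ _))//.
by rewrite lerD// dual_norm_ge.
Qed.

Let dual_normZ_le (a : R) f : dual_norm (a *: f) <= `|a| * dual_norm f.
Proof.
apply: dual_norm_le => x x1.
by rewrite dualZ normrM ler_wpM2l// dual_norm_ge.
Qed.

Lemma dual_normZ (a : R) f : dual_norm (a *: f) = `|a| * dual_norm f.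
Proof.
apply/eqP; rewrite eq_le dual_normZ_le/=.
have [->|a0] := eqVneq a 0; first by rewrite normr0 mul0r dual_norm_ge0.
rewrite mulrC -ler_pdivlMr ?normr_gt0// mulrC -normfV.
by rewrite -{1}(scale1r f) -(mulVf a0) -scalerA dual_normZ_le.
Qed.

Lemma dual_norm_eq0 f : dual_norm f = 0 -> f = 0.
Proof.
move=> f0; apply: dualP => x; apply/eqP; rewrite -normr_le0.
by have := le_dual_norm f x; rewrite f0 mul0r.
Qed.

HB.instance Definition _ :=
  Lmodule_isNormed.Build R dual dual_normD dual_normZ dual_norm_eq0.

Lemma dual_normE f : `|f| = dual_norm f.
Proof. by []. Qed.

Lemma ler_dual f x : `|f x| <= `|f| * `|x|.
Proof. exact: le_dual_norm. Qed.

End Dual.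

Section Bidual.
Variables (R : realType) (E : normedModType R).

Lemma bidual_subproof (x : E) :
  (fun f : dual E => f x : R^o) \in @dual_pred R (dual E).
Proof.
have lx : linear (fun f : dual E => f x : R^o) by [].
apply/asboolP; split=> //.
pose ev := HB.pack_for {linear dual E -> R^o} (fun f : dual E => f x : R^o)
  (GRing.isLinear.Build R (dual E) R^o *:%R _ lx).
apply: (@bounded_linear_continuous R (dual E) R^o ev).
apply/bounded_funP => r; exists (r * `|x|) => f fr.
by rewrite (le_trans (ler_dual f x))// ler_wpM2r.
Qed.

(* The canonical embedding of [E] into its bidual. *)
Definition to_bidual (x : E) : dual (dual E) := Dual (bidual_subproof x).

End Bidual.

Section Geometry.
Variables (R : realType) (E : normedModType R).

Definition extreme_points (C : set E) : set E :=
  [set x | C x /\ forall (y z : E) (t : R), C y -> C z -> 0 < t < 1 ->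
     x = t *: y + (1 - t) *: z -> y = x /\ z = x].

Definition line (v : E) : set E := [set a *: v | a in [set: R]].

Definition closed_subspace (M : set E) : Prop :=
  closed M /\ submod_closed [pred v | v \in M].

(* [l1_decomposition M N] reads $E = M \oplus_1 N$. *)
Definition l1_decomposition (M N : set E) : Prop :=
  [/\ closed_subspace M, closed_subspace N,
      M `&` N = [set 0],
      forall v, exists m n, [/\ M m, N n & v = m + n] &
      forall m n, M m -> N n -> `|m + n| = `|m| + `|n|].

Definition norming (x : E) (f : dual E) : Prop := `|f| = 1 /\ f x = `|x|.

Definition smooth_point (x : E) : Prop := x != 0 /\ exists! f, norming x f.

Definition frechet_smooth_point (x : E) : Prop :=
  smooth_point x /\
  forall f, norming x f ->
    (`|x + y| - `|x| - f y) / `|y| @[y --> 0^'] --> (0 : R).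

End Geometry.

Definition very_smooth_point (R : realType) (E : normedModType R) (x : E) :
    Prop :=
  smooth_point x /\ smooth_point (to_bidual x).

(* Main.v *)
Require Import Defs.
From HB Require Import structures.
From mathcomp Require Import all_boot all_order all_algebra.
From mathcomp Require Import boolp classical_sets functions reals.
From mathcomp Require Import topology normedtype.
From mathcomp Require Import lra.

(* The norming functional e of a smooth point x is extreme in the dual ball, so
   X* = span{e} (+)_1 N. If the restriction of x to N had norm |x|, Hahn-Banach
   on X** would give a functional norming x that vanishes on the coordinate
   functional of e, hence differs from e, against smoothness of x in X**. Thus that
   restriction has norm r < |x|, and for |y| < (|x| - r) / 2 the value
   |x + y| = max (|x| + e(y), |(x + y)|_N|) is |x| + e(y): the norm is affine
   near x. *)

Set Implicit Arguments.
Unset Strict Implicit.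
Unset Printing Implicit Defensive.

Import Order.TTheory GRing.Theory Num.Theory.
Import numFieldNormedType.Exports.

Local Open Scope classical_set_scope.
Local Open Scope ring_scope.

(** * Sublinear functionals and the Hahn-Banach theorem *)

Section Sublinear.
Context {R : realType} {V : lmodType R}.
Implicit Types (p q : V -> R) (u v : V).

(** Homogeneity is an inequality for [t > 0], a form that infima inherit easily; equality follows by
    scaling back with [t^-1]. *)
Definition sublinear p : Prop :=
  (forall u v, p (u + v) <= p u + p v) /\
  (forall t v, 0 < t -> p (t *: v) <= t * p v).

Lemma sublinear0 p : sublinear p -> p 0 = 0.
Proof.
move=> [pD pZ]; have := pD 0 0; have := pZ (2^-1) 0.
rewrite addr0 scaler0 invr_gt0 ltr0n => /(_ isT) h1 h2; lra.
Qed.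

Lemma sublinearZ p t v : sublinear p -> 0 <= t -> p (t *: v) = t * p v.
Proof.
move=> sp; rewrite le_eqVlt => /predU1P[<-|t0].
  by rewrite scale0r mul0r sublinear0.
case: sp => _ pZ; apply/eqP; rewrite eq_le pZ//=.
rewrite -ler_pdivlMl//; have := pZ t^-1 (t *: v).
by rewrite invr_gt0 scalerA mulVf ?gt_eqF// scale1r; exact.
Qed.

Lemma sublinear_geN p v : sublinear p -> - p (- v) <= p v.
Proof.
move=> sp; have := sp.1 v (- v); rewrite subrr sublinear0// => h; lra.
Qed.

(** The conditions bear on the family, with an index [k] of choice, so that they cover both the
    shifts of one functional and a chain of functionals. *)
Lemma sublinear_inf (I : Type) (D : set I) (F : I -> V -> R) :
  D !=set0 ->
  (forall u, has_lbound [set F i u | i in D]) ->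
  (forall i j u v, D i -> D j ->
    exists2 k, D k & F k (u + v) <= F i u + F j v) ->
  (forall i t u, D i -> 0 < t -> exists2 k, D k & F k (t *: u) <= t * F i u) ->
  sublinear (fun u => inf [set F i u | i in D]).
Proof.
move=> [i0 Di0] lbF FD FZ.
have infF i u : D i -> inf [set F i u | i in D] <= F i u.
  by move=> Di; apply: ge_inf; [exact: lbF | exists i].
have leinf u m : (forall i, D i -> m <= F i u) ->
    m <= inf [set F i u | i in D].
  move=> mF; apply: lb_le_inf; first by exists (F i0 u), i0.
  by move=> _ [i Di <-]; exact: mF.
split=> [u v|t v t0] /=.
- rewrite -lerBlDl; apply: (leinf) => j Dj.
  rewrite lerBlDl -lerBlDr; apply: (leinf) => i Di.
  have [k Dk Fk] := FD i j u v Di Dj.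
  by rewrite lerBlDr (le_trans (infF _ _ Dk)).
- rewrite -ler_pdivrMl//; apply: (leinf) => i Di.
  rewrite ler_pdivrMl//; have [k Dk Fk] := FZ i t v Di t0.
  exact: le_trans (infF _ _ Dk) Fk.
Qed.

(* The witness is [q u = inf_(t >= 0) p (u + t v) - t p v]. *)
Lemma sublinear_shift p v : sublinear p ->
  exists q, [/\ sublinear q, forall u, q u <= p u &
    forall u t, 0 <= t -> q u <= p (u + t *: v) - t * p v].
Proof.
move=> sp; pose F (t : R) u := p (u + t *: v) - t * p v.
pose D := [set t : R | 0 <= t].
have lbF u : has_lbound [set F i u | i in D].
  (* The lower bound comes from writing [t v = - u + (u + t v)]. *)
  exists (- p (- u)) => _ [t t0 <-]; rewrite /F -sublinearZ//.
  have := sp.1 (- u) (u + t *: v); rewrite addKr => h; lra.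
have infF t u : 0 <= t -> inf [set F i u | i in D] <= F t u.
  by move=> t0; apply: ge_inf => //; exists t.
exists (fun u => inf [set F i u | i in D]); split.
- apply: sublinear_inf => //; first by exists 0; exact: lexx.
  + move=> s t u w s0 t0; exists (s + t); first exact: addr_ge0.
    rewrite /F scalerDl addrACA.
    have := sp.1 (u + s *: v) (w + t *: v) => h; lra.
  + move=> s t u s0 t0; exists (t * s); first exact: (mulr_ge0 (ltW t0)).
    by rewrite /F -scalerA -scalerDr sublinearZ ?(ltW t0)// mulrBr mulrA.
- move=> u; apply: le_trans (infF 0 u _) _ => //.
  by rewrite /F scale0r mul0r subr0 addr0.
- by move=> u t; exact: infF.
Qed.

(** Zorn's lemma for the reversed pointwise order: the infimum of a chain is sublinear, since the
    smaller of two members serves for both. *)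
Lemma minimal_sublinear p : sublinear p ->
  exists q, [/\ sublinear q, forall u, q u <= p u &
    forall q', sublinear q' -> (forall u, q' u <= q u) -> q' = q].
Proof.
move=> sp; pose T := {q | sublinear q /\ forall u, q u <= p u}.
pose le (f g : T) := `[< forall u, sval g u <= sval f u >].
have val_eq (f g : T) : sval f = sval g -> f = g.
  by case: f g => [f pf] [g pg] /= fg; exact: eq_exist.
have [] := @Zorn T le.
- by move=> f; apply/asboolP.
- move=> f g h /asboolP fg /asboolP gh; apply/asboolP => u.
  exact: le_trans (gh u) (fg u).
- move=> f g /asboolP fg /asboolP gf; apply/val_eq/funext => u.
  by apply/eqP; rewrite eq_le fg gf.
- move=> A Atot; have [[a Aa]|A0] := pselect (A !=set0); last first.
    by exists (exist _ p (conj sp (fun u => lexx (p u)))) => s As;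
      exfalso; apply: A0; exists s.
  have lbA u : has_lbound [set sval f u | f in A].
    exists (- p (- u)) => _ [f Af <-]; have [sf fp] := svalP f.
    by rewrite (le_trans _ (sublinear_geN _ sf))// lerN2.
  have infA f u : A f -> inf [set sval f u | f in A] <= sval f u.
    by move=> Af; apply: ge_inf => //; exists f.
  have sA : sublinear (fun u => inf [set sval f u | f in A]).
    apply: sublinear_inf => //; first by exists a.
    + move=> f g u v Af Ag; have [sf _] := svalP f; have [sg _] := svalP g.
      have [/asboolP fg|/asboolP gf] := Atot _ _ Af Ag.
        by exists g => //; rewrite (le_trans (sg.1 _ _))// lerD2r.
      by exists f => //; rewrite (le_trans (sf.1 _ _))// lerD2l.
    + by move=> f t u Af t0; exists f => //; apply: (svalP f).1.2.
  have pA u : inf [set sval f u | f in A] <= p u.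
    by apply: le_trans (infA a u Aa) _; apply: (svalP a).2.
  exists (exist _ (fun u => inf [set sval f u | f in A]) (conj sA pA) : T).
  move=> f Af; apply/asboolP => u /=.
  exact: infA.
- move=> [q [sq qp]] qmin; exists q; split=> // q' sq' q'q.
  have q'p u : q' u <= p u by exact: le_trans (q'q u) (qp u).
  have := qmin (exist _ q' (conj sq' q'p) : T).
  by move=> /(_ (asboolT q'q)) [].
Qed.

(** By minimality [p] equals its shift along [v], whose bound at [t = 1] is superadditivity. *)
Lemma minimal_sublinear_linear p : sublinear p ->
  (forall q, sublinear q -> (forall u, q u <= p u) -> q = p) ->
  linear (p : V -> R^o).
Proof.
move=> sp pmin.
have pD u v : p (u + v) = p u + p v.
  apply/eqP; rewrite eq_le sp.1 /=.
  have [q [sq qp qv]] := sublinear_shift v sp.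
  have := qv u 1 ler01; rewrite (pmin q sq qp) scale1r mul1r => h; lra.
have pN u : p (- u) = - p u.
  by apply/eqP; rewrite -addr_eq0 -pD addNr sublinear0.
have pZ t u : p (t *: u) = t * p u.
  have [t0|/ltW t0] := leP 0 t; first exact: sublinearZ.
  have := sublinearZ u sp (_ : 0 <= - t); rewrite oppr_ge0 => /(_ t0).
  by rewrite scaleNr pN mulNr => /oppr_inj.
by move=> t u v; rewrite pD pZ.
Qed.

(* A minimal sublinear functional is linear; starting the descent from the
   shift of [p] along [v] forces the value at [v]. *)
Theorem hahn_banach p v : sublinear p ->
  exists f : V -> R^o, [/\ linear f, forall u, f u <= p u & f v = p v].
Proof.
move=> sp; have [q [sq qp qv]] := sublinear_shift v sp.
have [f [sf fq fmin]] := minimal_sublinear sq.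
have lf := minimal_sublinear_linear sf fmin.
exists f; split=> // [u|]; first exact: le_trans (fq u) (qp u).
apply/eqP; rewrite eq_le (le_trans (fq v) (qp v))/=.
(* At [u = - v] and [t = 1] the shift bound reads [q (- v) <= - p v], whence [p v <= f v]. *)
have := qv (- v) 1 ler01; rewrite scale1r addNr sublinear0// mul1r sub0r => qNv.
have fNN : f (- v) = - f v.
  by have := lf (-1) v 0; rewrite addr0 scaleN1r sublinear0// addr0 scaleN1r.
have := fq (- v); rewrite fNN => h; lra.
Qed.

End Sublinear.

(** * Bounded linear functionals as elements of the dual *)

Section BoundedFunctionals.
Context {R : realType} {E : normedModType R}.
Implicit Types (v : E) (f : dual E).

Lemma dual_of_bounded (g : E -> R^o) (C : R) : linear g ->
  (forall v, `|g v| <= C * `|v|) -> exists f, forall v, f v = g v.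
Proof.
move=> lg gC; have C0 : 0 <= `|C| by [].
pose G := HB.pack_for {linear E -> R^o} g
  (GRing.isLinear.Build R E R^o *:%R _ lg).
have cg : continuous g.
  apply: (@bounded_linear_continuous R E R^o G).
  apply/bounded_funP => r; exists (`|C| * r) => v vr.
  rewrite (le_trans (gC v))// (@le_trans _ _ (`|C| * `|v|))//.
    by rewrite ler_wpM2r// ler_norm.
  by rewrite ler_wpM2l.
have gP : g \in @dual_pred R E by apply/asboolP.
by exists (Dual gP).
Qed.

Lemma dualBZ f (a : R) u v : f (u - a *: v) = f u - a * f v.
Proof. by rewrite linearB linearZ. Qed.

Lemma dual_norm_bound f C :
  0 <= C -> (forall v, `|f v| <= C * `|v|) -> `|f| <= C.
Proof.
move=> C0 fC; rewrite dual_normE; apply: dual_norm_le => v v1.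
by rewrite (le_trans (fC v))// ler_piMr.
Qed.

End BoundedFunctionals.

(** * Norming functionals and extreme points of the dual ball *)

Section NormingFunctionals.
Context {R : realType} {E : normedModType R}.
Implicit Types (v : E) (f : dual E).

(** Evenness of [p] turns the one-sided Hahn-Banach bound into a bound on absolute values;
    domination by the norm makes [f] continuous. *)
Lemma hahn_banach_seminorm (p : E -> R) v : sublinear p ->
  (forall u, p (- u) = p u) -> (forall u, p u <= `|u|) ->
  exists f, [/\ `|f| <= 1, forall u, `|f u| <= p u & f v = p v].
Proof.
move=> sp pN p1; have [g [lg gp gv]] := hahn_banach v sp.
have gN u : g (- u) = - g u.
  have g0 : g 0 = 0.
    by have := lg (-1) 0 0; rewrite scaler0 addr0 scaleN1r addNr.
  by have := lg (-1) u 0; rewrite g0 !addr0 !scaleN1r.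
have agp u : `|g u| <= p u.
  by rewrite ler_norml gp andbT lerNl -gN -[leRHS]pN gp.
have ag1 u : `|g u| <= 1 * `|u| by rewrite mul1r (le_trans (agp u)).
have [f fg] := dual_of_bounded lg ag1; exists f; split.
- by apply: dual_norm_bound => // u; rewrite fg.
- by move=> u; rewrite fg.
- by rewrite fg.
Qed.

Lemma normr_sublinear : sublinear (fun v : E => `|v|).
Proof.
split=> [u v|t v t0]; first exact: ler_normD.
by rewrite normrZ gtr0_norm.
Qed.

(** A norm bound in place of [norming] keeps [v = 0] in scope, even in the trivial space. *)
Lemma exists_norming_le1 v : exists2 f : dual E, `|f| <= 1 & f v = `|v|.
Proof.
have [f [f1 _ fv]] := hahn_banach_seminorm v normr_sublinear
  (@normrN _ _) (fun u => lexx `|u|).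
by exists f.
Qed.

Lemma norm_to_bidual v : `|to_bidual v| = `|v|.
Proof.
apply/eqP; rewrite eq_le; apply/andP; split.
  by apply: dual_norm_bound => // f; rewrite mulrC; exact: (ler_dual f v).
have [f f1 fv] := exists_norming_le1 v.
rewrite -fv (le_trans (ler_norm _))//.
by rewrite (le_trans (ler_dual (to_bidual v) f))// ler_piMr.
Qed.

(** A functional in the dual ball with value [|v|] at [v] is norming, hence equal to [f]; a convex
    combination with positive weights reaches this maximum only if both terms do. *)
Lemma smooth_norming_extreme v f : smooth_point v -> norming v f ->
  extreme_points (closed_unit_ball (dual E)) f.
Proof.
move=> [v0 [f0 [_ f0u]]] [f1 fv].
have v_gt0 : 0 < `|v| by rewrite normr_gt0.
have ball_le (g : dual E) : `|g| <= 1 -> g v <= `|v|.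
  move=> g1; apply: le_trans (ler_norm _) _.
  by rewrite (le_trans (ler_dual g v))// ler_piMl.
have ball_eq (g : dual E) : `|g| <= 1 -> g v = `|v| -> g = f.
  move=> g1 gv; rewrite -(f0u f)//; apply/esym/f0u; split=> //.
  apply/eqP; rewrite eq_le g1 /= -(ler_pM2r v_gt0) mul1r -[leLHS]gv.
  exact: le_trans (ler_norm _) (ler_dual g v).
split; first by rewrite /closed_unit_ball/= f1.
move=> g h t g1 h1 /andP[t0 t1] fE.
have gv := ball_le _ g1; have hv := ball_le _ h1.
have : f v = t * g v + (1 - t) * h v by rewrite fE.
rewrite fv => vE; split; apply: ball_eq => //; nra.
Qed.

End NormingFunctionals.

(** * The coordinate functional of a one-dimensional l1-summand *)

Lemma l1_line_coord (R : realType) (E : normedModType R) (e : E) (N : set E) :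
  `|e| = 1 -> l1_decomposition (line e) N ->
  exists P : dual E, P e = 1 /\
    forall v, `|v| = `|P v| + `|v - P v *: e|.
Proof.
move=> e1 [_ [_ [N0 Nlin]] capN dec nD].
have {}Nlin a u v : N u -> N v -> N (a *: u + v).
  move=> Nu Nv; have := Nlin a u v; rewrite !inE/=; exact.
have {}N0 : N 0 by move: N0; rewrite !inE.
have NB u v : N u -> N v -> N (u - v).
  by move=> Nu Nv; rewrite addrC -scaleN1r; exact: Nlin.
have /choice[P PN] : forall v, exists a, N (v - a *: e).
  move=> v; have [m [n [[a _ <-] Nn ->]]] := dec v.
  by exists a; rewrite addrC addKr.
have e0 : e != 0 by rewrite -normr_eq0 e1 oner_eq0.
(* The coordinate is unique because [line e] meets [N] only in 0; linearity of [P] and [P e = 1]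
   both follow from this. *)
have uniq v a : N (v - a *: e) -> P v = a.
  move=> Na; have := NB _ _ Na (PN v).
  rewrite opprB addrC addrA subrK -scalerBl => Nae.
  have : (line e `&` N) ((P v - a) *: e) by split => //; exists (P v - a).
  by rewrite capN => /eqP; rewrite scaler_eq0 (negPf e0) orbF subr_eq0 => /eqP.
have norm v : `|v| = `|P v| + `|v - P v *: e|.
  rewrite -[in LHS](subrK (P v *: e) v) addrC nD//; last by exists (P v).
  by rewrite normrZ e1 mulr1.
have lP : linear (P : E -> R^o).
  move=> a u v; apply: uniq.
  have := Nlin a _ _ (PN u) (PN v).
  by rewrite scalerBr addrACA -opprD scalerA -scalerDl.
have PB v : `|P v| <= 1 * `|v| by rewrite mul1r [leRHS]norm lerDl.
have [Q QP] := dual_of_bounded lP PB.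
exists Q; split=> [|v]; last by rewrite QP.
by rewrite QP; apply: uniq; rewrite scale1r subrr.
Qed.

(** * The norm is affine near a very smooth point *)

Theorem theorem3 (R : realType) (X : completeNormedModType R)
  (hX : forall f : dual X, extreme_points (closed_unit_ball (dual X)) f ->
     exists N : set (dual X), l1_decomposition (line f) N)
  (x : X) (hx : very_smooth_point x) :
  frechet_smooth_point x.
Proof.
have [sx [_ [L [_ Luniq]]]] := hx; split=> // e ne; have [e1 ex] := ne.
have [N /l1_line_coord -/(_ e1) [P [Pe Pnorm]]] :=
  hX _ (smooth_norming_extreme sx ne).
have [x0 _] := sx; have x_gt0 : 0 < `|x| by rewrite normr_gt0.
(* [p F] is the norm of the restriction of [F] to the complement of [e],
   because [f |-> f - P f *: e] is a contractive projection onto it. *)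
pose p (F : dual (dual X)) : R := `|F - F e *: P|.
have pE (F : dual (dual X)) f : (F - F e *: P) f = F (f - P f *: e).
  by rewrite dualBZ [P f * _]mulrC.
have p_le F : p F <= `|F|.
  apply: dual_norm_bound => // f; rewrite pE (le_trans (ler_dual _ _))//.
  by rewrite ler_wpM2l// [leRHS]Pnorm lerDr.
have pN F : p (- F) = p F.
  rewrite /p -normrN; congr `|_|.
  by rewrite opprB opprK addrC -scaleNr.
have sp : sublinear p.
  split=> [F G|t F t0].
    rewrite /p (_ : _ - _ = (F - F e *: P) + (G - G e *: P)) ?ler_normD//.
    by rewrite addrACA -opprD -scalerDl.
  rewrite /p (_ : _ - _ = t *: (F - F e *: P)) ?normrZ ?gtr0_norm//.
  by rewrite scalerBr scalerA.
have px : p (to_bidual x) < `|x|.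
  rewrite lt_neqAle -{2}norm_to_bidual p_le andbT; apply/eqP => px.
  have [G [G1 Gp Gx]] := hahn_banach_seminorm (to_bidual x) sp pN p_le.
  have nG : norming (to_bidual x) G.
    split; last by rewrite Gx px norm_to_bidual.
    apply/eqP; rewrite eq_le G1 /= -(ler_pM2r x_gt0) mul1r -[leLHS]px -Gx.
    by rewrite (le_trans (ler_norm _))// (le_trans (ler_dual _ _))//
      norm_to_bidual.
  (* Seen in the third dual, [e] also norms [x], so uniqueness forces [G] to be evaluation at [e],
     against [G P = 0] and [P e = 1]. *)
  have nE : norming (to_bidual x) (to_bidual e).
    by split; rewrite norm_to_bidual.
  have GP : G P = 0.
    apply/eqP; rewrite -normr_le0 (le_trans (Gp P))//.
    by rewrite /p Pe scale1r subrr normr0.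
  have : G P = to_bidual e P by rewrite -(Luniq _ nG) -(Luniq _ nE).
  by rewrite GP [RHS]Pe => /esym/eqP; rewrite oner_eq0.
set r := p (to_bidual x) in px.
have r0 : 0 <= r := normr_ge0 _.
(* The radius is chosen so that [r + |y| < |x| - |y| <= |x| + e y]. *)
have affine (y : X) : `|y| < (`|x| - r) / 2 -> `|x + y| = `|x| + e y.
  move=> yr.
  apply/eqP; rewrite eq_le; apply/andP; split; last first.
    rewrite -ex -raddfD (le_trans (ler_norm _))//.
    by rewrite (le_trans (ler_dual _ _))// e1 mul1r.
  (* In [f = P f *: e + n] the norms add up to at most 1, and each part contributes at most
     [|x| + e y] per unit of norm. *)
  have [f f1 fxy] := exists_norming_le1 (x + y).
  set n := f - P f *: e.
  have nx : n x <= r * `|n|.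
    (* As [P n = 0], evaluation at [x] agrees on [n] with the functional of norm [r]. *)
    have -> : n x = (to_bidual x - to_bidual x e *: P) n.
      rewrite pE /n.
      have -> : P (f - P f *: e) = 0.
        by rewrite dualBZ Pe mulr1 subrr.
      by rewrite scale0r subr0.
    exact: le_trans (ler_norm _) (ler_dual _ _).
  have ny : n y <= `|n| * `|y| := le_trans (ler_norm _) (ler_dual _ _).
  have fE : `|x + y| = P f * (`|x| + e y) + (n x + n y).
    rewrite -fxy -ex -!raddfD /=.
    by rewrite -[f in LHS](subrK (P f *: e)) addrC.
  have /ler_normlP[ey1 ey2] : `|e y| <= `|y|.
    by rewrite (le_trans (ler_dual _ _))// e1 mul1r.
  have nf : `|f| = `|P f| + `|n| := Pnorm f.
  rewrite nf in f1; rewrite fE.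
  have xy0 : 0 <= `|x| + e y by have := normr_ge0 y; lra.
  have Pxy : P f * (`|x| + e y) <= `|P f| * (`|x| + e y).
    by rewrite ler_wpM2r// ler_norm.
  have nxy : `|n| * (r + `|y|) <= `|n| * (`|x| + e y).
    by rewrite ler_wpM2l//; lra.
  have fxy_le : (`|P f| + `|n|) * (`|x| + e y) <= 1 * (`|x| + e y).
    by rewrite ler_wpM2r.
  lra.
(* Near 0 the difference quotient is identically 0. *)
apply/cvgrPdist_le => eps eps0; near=> y.
rewrite affine.
  by rewrite [_ + e y]addrC addrK subrr mul0r subrr normr0 ltW.
near: y; apply: nbhs_dnbhs; apply: nbhs0_lt; lra.
Unshelve. all: by end_near.
Qed.
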